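(* There is a universal constant $c_0>0$ such that the following holds. For any $0<\delta\le L$, $n\ge 2$, $D>0$ and $0<\varepsilon\le\delta D^2/(16\sqrt{2n})$, there exist dimensions $d_x,d_y$, $L$-smooth and convex-concave functions $f_1,\dots,f_n:\mathbb{R}^{d_x}\times\mathbb{R}^{d_y}\to\mathbb{R}$ with $\delta$-second-order similarity, and a closed convex set $\mathcal{Z}=\mathcal{X}\times\mathcal{Y}$ with diameter $D$, such that any DFO algorithm that finds an approximate solution $z=(x,y)$ of $\min_{x\in\mathcal{X}}\max_{y\in\mathcal{Y}}\frac1n\sum_{i=1}^n f_i(x,y)$ with $\mathbb{E}[\operatorname{Gap}(z)]\le\varepsilon$ needs at least $c_0\,\big(n+(\sqrt{n}\,\delta+L)D^2/\varepsilon\big)$ local gradient calls (i.e. $\Omega(n+(\sqrt{n}\delta+L)D^2/\varepsilon)$).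
   Context: $f=\frac1n\sum_{i=1}^n f_i$; $\operatorname{Gap}(x,y)=\max_{y'\in\mathcal{Y}}f(x,y')-\min_{x'\in\mathcal{X}}f(x',y)$. $F_i(z)=[\nabla_x f_i;-\nabla_y f_i]$; ''$L$-smooth'': $\|F_i(z_1)-F_i(z_2)\|\le L\|z_1-z_2\|$ for all $i,z_1,z_2$. ''Convex-concave'': convex in $x$, concave in $y$. ''$\delta$-second-order similarity'': the $f_i$ are twice differentiable and $\|\nabla^2 f_i(x,y)-\nabla^2 f(x,y)\|\le\delta$ for all $i,x,y$ (spectral norm). Diameter $D$ of $\mathcal{Z}$: $\|z_1-z_2\|\le D$ for all $z_1,z_2\in\mathcal{Z}$. Distributed first-order oracle (DFO) algorithm: node $1$ is the server (holding $f_1$), nodes $2,\dots,n$ are clients (node $i$ holding $f_i$). Each node $i$ has local memories $\mathcal{M}_i^x,\mathcal{M}_i^y$, initialized as $\{0\}$, updated as follows. - Communication from clients to server: in one communication round, sample uniformly and independently a batch $\mathcal{S}$ of any size $b$ of nodes; the server may add points $x_1'\in\operatorname{span}\{x_1,\bigcup_{i\in\mathcal{S}}x_i\}$, $y_1'\in\operatorname{span}\{y_1,\bigcup_{i\in\mathcal{S}}y_i\}$ with $x_i\in\mathcal{M}_i^x$, $y_i\in\mathcal{M}_i^y$ to its memories; this costs $b$ communication complexity. Batch size $n$ means all clients send. - Communication from server to clients: in one communication round, sample uniformly and independently a batch $\mathcal{S}$ of any size $b$; each client $i\in\mathcal{S}$ may add $x_i'\in\operatorname{span}\{x_1,x_i\}$,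 $y_i'\in\operatorname{span}\{y_1,y_i\}$ with $x_i\in\mathcal{M}_i^x,y_i\in\mathcal{M}_i^y$ to its memories; this costs $b$ communication complexity. - Local computations: node $i$ may add $x_i'\in\operatorname{span}\{x',\nabla_x f_i(x'',y'')\}$, $y_i'\in\operatorname{span}\{y',\nabla_y f_i(x'',y'')\}$ for $x',x''\in\mathcal{M}_i^x$, $y',y''\in\mathcal{M}_i^y$ to its memories; local gradient calls count the applications of $\nabla_x,\nabla_y$ to any $f_i$. The final output is some $\hat x\in\mathcal{M}_1^x$, $\hat y\in\mathcal{M}_1^y$. Expectation is over the algorithm's randomness. *)

(* Defs.v *)
From HB Require Import structures.
From mathcomp Require Import all_boot all_order all_algebra.
From mathcomp Require Import all_classical all_reals all_analysis.

Set Implicit Arguments.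
Unset Strict Implicit.
Unset Printing Implicit Defensive.

Import Order.TTheory GRing.Theory Num.Theory.
Import numFieldNormedType.Exports.

Local Open Scope classical_set_scope.
Local Open Scope ring_scope.

(* The norm that MathComp-Analysis puts on matrices is the sup norm, hence the
   Euclidean and spectral norms below. *)
Definition enorm (R : realType) (d : nat) (v : 'rV[R]_d) : R :=
  Num.sqrt (\sum_j v 0 j ^+ 2).

Definition spectral_norm (R : realType) (d : nat) (A : 'M[R]_d) : R :=
  sup [set enorm (v *m A) | v in [set v : 'rV[R]_d | enorm v <= 1]].

Section calculus.
Context {R : realType} {dx dy : nat}.

(* A function of (x, y) is encoded as a function of z = row_mx x y. *)
Local Notation fct := ('rV[R]_(dx + dy) -> R).

Definition gradient (f : fct) (z : 'rV[R]_(dx + dy)) : 'rV[R]_(dx + dy) :=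
  \row_j 'D_(delta_mx 0 j) f z.

Definition gradient_x (f : fct) (x : 'rV[R]_dx) (y : 'rV[R]_dy) : 'rV[R]_dx :=
  lsubmx (gradient f (row_mx x y)).

Definition gradient_y (f : fct) (x : 'rV[R]_dx) (y : 'rV[R]_dy) : 'rV[R]_dy :=
  rsubmx (gradient f (row_mx x y)).

Definition hessian (f : fct) (z : 'rV[R]_(dx + dy)) : 'M[R]_(dx + dy) :=
  'J (gradient f) z.

Definition gradient_field (f : fct) (z : 'rV[R]_(dx + dy)) :
    'rV[R]_(dx + dy) :=
  row_mx (gradient_x f (lsubmx z) (rsubmx z))
         (- gradient_y f (lsubmx z) (rsubmx z)).

Definition L_smooth (L : R) (f : fct) : Prop :=
  (forall z, differentiable f z) /\
  forall z1 z2, enorm (gradient_field f z1 - gradient_field f z2)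
                <= L * enorm (z1 - z2).

Definition convex_concave (f : fct) : Prop :=
  (forall y : 'rV[R]_dy, convex_function setT
     (fun x : 'rV[R]_dx => f (row_mx x y))) /\
  (forall x : 'rV[R]_dx, convex_function setT
     (fun y : 'rV[R]_dy => - f (row_mx x y))).

Definition twice_differentiable (f : fct) : Prop :=
  forall z, differentiable f z /\ differentiable (gradient f) z.

Definition average (n : nat) (f : 'I_n -> fct) : fct :=
  fun z => n%:R^-1 * \sum_i f i z.

Definition second_order_similarity (delta : R) (n : nat) (f : 'I_n -> fct) :
    Prop :=
  (forall i, twice_differentiable (f i)) /\
  forall i z, spectral_norm (hessian (f i) z - hessian (average f) z) <= delta.

Definition product_set (X : set 'rV[R]_dx) (Y : set 'rV[R]_dy) :
    set 'rV[R]_(dx + dy) :=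
  [set z | X (lsubmx z) /\ Y (rsubmx z)].

(* For X, Y compact and nonempty, sup and inf are the max and min. *)
Definition Gap (f : fct) (X : set 'rV[R]_dx) (Y : set 'rV[R]_dy)
    (x : 'rV[R]_dx) (y : 'rV[R]_dy) : R :=
  sup [set f (row_mx x y') | y' in Y] - inf [set f (row_mx x' y) | x' in X].

End calculus.

Definition has_diameter (R : realType) (d : nat) (D : R) (Z : set 'rV[R]_d) :
    Prop :=
  forall z1 z2, Z z1 -> Z z2 -> enorm (z1 - z2) <= D.

(* One elementary step: a communication round with its batch size (clients to
   server, or server to clients), or one application of nabla_x f_i or of
   nabla_y f_i at node i.  A local computation that updates both x and y is two
   steps, as it applies nabla_x and nabla_y once each. *)
Variant command (n : nat) : Type :=
  | ClientsToServer of 'I_n.+1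
  | ServerToClients of 'I_n.+1
  | LocalX of 'I_n
  | LocalY of 'I_n.

Definition batch_size (n : nat) (c : command n) : option nat :=
  match c with
  | ClientsToServer b | ServerToClients b => Some (b : nat)
  | LocalX _ | LocalY _ => None
  end.

Definition is_gradient_call (n : nat) (c : command n) : bool :=
  match c with
  | LocalX _ | LocalY _ => true
  | ClientsToServer _ | ServerToClients _ => false
  end.

Section rules.
Context {R : realType} {n dx dy : nat}.
Variables (server : 'I_n) (f : 'I_n -> 'rV[R]_(dx + dy) -> R).

(* M k is the memory of node k; the results are the vectors that node i may
   add to its own memory. *)
Definition from_clients (d : nat) (M : 'I_n -> set 'rV[R]_d)
    (S : {set 'I_n}) (i : 'I_n) : set 'rV[R]_d :=
  [set v | i = server /\
    exists2 u : 'I_n -> 'rV[R]_d, forall k, M k (u k) &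
      v \in <<u server :: [seq u k | k in S]>>%VS].

Definition from_server (d : nat) (M : 'I_n -> set 'rV[R]_d)
    (S : {set 'I_n}) (i : 'I_n) : set 'rV[R]_d :=
  [set v | [/\ i \in S, i != server &
    exists v1 vi, [/\ M server v1, M i vi & v \in <<[:: v1; vi]>>%VS]]].

Definition addable_x (c : command n) (S : {set 'I_n})
    (Mx : 'I_n -> set 'rV[R]_dx) (My : 'I_n -> set 'rV[R]_dy) (i : 'I_n) :
    set 'rV[R]_dx :=
  match c with
  | ClientsToServer _ => from_clients Mx S i
  | ServerToClients _ => from_server Mx S i
  | LocalX k => [set v | i = k /\ exists x1 x2 y2,
      [/\ Mx k x1, Mx k x2, My k y2 &
          v \in <<[:: x1; gradient_x (f k) x2 y2]>>%VS]]
  | LocalY _ => set0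
  end.

Definition addable_y (c : command n) (S : {set 'I_n})
    (Mx : 'I_n -> set 'rV[R]_dx) (My : 'I_n -> set 'rV[R]_dy) (i : 'I_n) :
    set 'rV[R]_dy :=
  match c with
  | ClientsToServer _ => from_clients My S i
  | ServerToClients _ => from_server My S i
  | LocalX _ => set0
  | LocalY k => [set v | i = k /\ exists y1 x2 y2,
      [/\ My k y1, Mx k x2, My k y2 &
          v \in <<[:: y1; gradient_y (f k) x2 y2]>>%VS]]
  end.

End rules.

(* The memory of node i after t steps, given the vectors stored so far. *)
Definition memory (R : realType) (n d : nat) (T : Type)
    (new : nat -> T -> 'I_n -> 'rV[R]_d) (t : nat) (w : T) (i : 'I_n) :
    set 'rV[R]_d :=
  [set v | v = 0 \/ exists2 s, (s < t)%N & v = new s w i].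

(* The random trajectory of a randomized algorithm on a fixed instance, over a
   sample space T carrying both its internal randomness and the batches:
   known t    -- the events determined by what is known before step t,
   cmd t      -- the step performed, chosen before its batch is drawn,
   batch t    -- the batch (used by communication rounds only),
   newx, newy -- the vectors stored by each node at step t,
   stop       -- the total number of steps,
   outx, outy -- the final output. *)
Record trajectory (R : realType) (n dx dy : nat) (T : Type) := Trajectory {
  known : nat -> set (set T);
  cmd : nat -> T -> command n;
  batch : nat -> T -> {set 'I_n};
  newx : nat -> T -> 'I_n -> 'rV[R]_dx;
  newy : nat -> T -> 'I_n -> 'rV[R]_dy;
  stop : T -> nat;
  outx : T -> 'rV[R]_dx;
  outy : T -> 'rV[R]_dy }.

(* A node that adds nothing at a step stores again a vector of its memory.
   In dfo_uniform, as A ranges over the sigma-algebra known t, the identity says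
   that, conditionally on the past, a batch of size b is uniform among the
   subsets of size b, hence independent of the past. *)
Record DFO (R : realType) (n dx dy : nat) (server : 'I_n)
    (f : 'I_n -> 'rV[R]_(dx + dy) -> R)
    (d : measure_display) (T : measurableType d) (P : probability T R)
    (a : trajectory R n dx dy T) : Prop := IsDFO {
  dfo_sigma_algebra : forall t, sigma_algebra [set: T] (known a t);
  dfo_measurable : forall t, known a t `<=` measurable;
  dfo_filtration : forall t, known a t `<=` known a t.+1;
  dfo_cmd : forall t c, known a t (cmd a t @^-1` [set c]);
  dfo_stop : forall t, known a t (stop a @^-1` [set t]);
  dfo_batch : forall t S, known a t.+1 (batch a t @^-1` [set S]);
  dfo_newx : forall t i j (B : set R), measurable B ->
    known a t.+1 ((fun w => newx a t w i 0 j) @^-1` B);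
  dfo_newy : forall t i j (B : set R), measurable B ->
    known a t.+1 ((fun w => newy a t w i 0 j) @^-1` B);
  dfo_outx : forall j, measurable_fun setT (fun w => outx a w 0 j);
  dfo_outy : forall j, measurable_fun setT (fun w => outy a w 0 j);
  dfo_uniform : forall t (A : set T) (b : nat) (S : {set 'I_n}),
    known a t A ->
    let round := A `&` [set w | (t < stop a w)%N]
                   `&` [set w | batch_size (cmd a t w) = Some b] in
    (P (round `&` batch a t @^-1` [set S]) =
     ((#|S| == b)%:R / 'C(n, b)%:R)%:E * P round)%E;
  dfo_step_x : forall t w i, (t < stop a w)%N ->
    let Mx := memory (newx a) t w in let My := memory (newy a) t w in
    (Mx i `|` addable_x server f (cmd a t w) (batch a t w) Mx My i)
      (newx a t w i);
  dfo_step_y : forall t w i, (t < stop a w)%N ->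
    let Mx := memory (newx a) t w in let My := memory (newy a) t w in
    (My i `|` addable_y server f (cmd a t w) (batch a t w) Mx My i)
      (newy a t w i);
  dfo_output_x : forall w, memory (newx a) (stop a w) w server (outx a w);
  dfo_output_y : forall w, memory (newy a) (stop a w) w server (outy a w) }.

Definition gradient_calls (R : realType) (n dx dy : nat) (T : Type)
    (a : trajectory R n dx dy T) (w : T) : nat :=
  (\sum_(t < stop a w) is_gradient_call (cmd a t w))%N.

(* Main.v *)
Require Import Defs.
From HB Require Import structures.
From mathcomp Require Import all_boot all_order all_algebra.
From mathcomp Require Import all_classical all_reals all_analysis.
From mathcomp Require Import ring lra.

Set Implicit Arguments.
Unset Strict Implicit.
Unset Printing Implicit Defensive.

Import Order.TTheory GRing.Theory Num.Theory.
Import numFieldNormedType.Exports.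

Local Open Scope classical_set_scope.
Local Open Scope ring_scope.

(** The hard instance is a bilinear game on a tree. Let [q] be an alphabet size
    and let node [i] own the letter [l i]. The coordinates of [x] and [y] are
    indexed by the nonempty words of length at most [N], and
      f_i(x, y) = a * (sum_w y_(l_i w) x_w - q^(-1/2) sum_v y_v x_v),
    where x_w stands for the constant s when w is empty. A gradient call at node
    [i] extends the words in the supports of the memories by the letter [l i]
    only, so the reachable words are the subwords of the word formed by the calls.
    As long as there are at most qN/32 calls, these are at most one word of
    length N in eight. Averaged over the nodes, the coupling is
      (a / sqrt q) * sum_v y_v res_v,
    with res_(jw) = x_w / sqrt q - x_(jw),
    and the residuals weighted by q^(|v|/2) telescope along every branch of the
    tree; averaging over the branches that were not explored gives
    |res|^2 >= (7/8) s^2 / N, while res = 0 has a solution of norm s sqrt N.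
    Hence the gap is at least of order a D^2 / (sqrt q N) on the event that there
    are at most qN/32 calls. Averaging the shifts by n distinct letters divides
    their norm by sqrt n only, although each of them has norm 1: this is the
    source of the factor sqrt n. The choice q = n, a = delta/2 gives
    sqrt n delta D^2 / eps, and q = 1, a = L/2 gives L D^2 / eps; the term n is
    dominated by the first bound, because eps <= delta D^2 / (16 sqrt (2n)). *)

(** * Euclidean norm *)

(** For [B > 0] the squares of [B * a i - S * b i] sum to [B * (A * B - S ^+ 2)], which is thus
    nonnegative; for [B = 0] every [b i] vanishes. *)
Lemma sum_CauchySchwarz (R : realFieldType) (I : finType) (a b : I -> R) :
  (\sum_i a i * b i) ^+ 2 <= (\sum_i a i ^+ 2) * (\sum_i b i ^+ 2).
Proof.
set S := \sum_i a i * b i; set A := \sum_i a i ^+ 2; set B := \sum_i b i ^+ 2.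
have B_ge0 : 0 <= B by apply: sumr_ge0 => i _; apply: sqr_ge0.
have [B0|B_neq0] := eqVneq B 0.
  have b0 i : b i = 0.
    apply/eqP; rewrite -sqrf_eq0; apply/eqP.
    by apply: psumr_eq0P B0 _ _ => // j _; apply: sqr_ge0.
  by rewrite /S big1 ?expr0n ?B0 ?mulr0 // => i _; rewrite b0 mulr0.
have : 0 <= \sum_i (B * a i - S * b i) ^+ 2.
  by apply: sumr_ge0 => i _; apply: sqr_ge0.
have -> : \sum_i (B * a i - S * b i) ^+ 2 = B * (A * B - S ^+ 2).
  under eq_bigr => i _.
    have -> : (B * a i - S * b i) ^+ 2 =
      B ^+ 2 * a i ^+ 2 + - (2 * B * S) * (a i * b i) + S ^+ 2 * b i ^+ 2.
      by ring.
    over.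
  by rewrite !big_split /= -!mulr_sumr -/S -/A -/B; ring.
by rewrite pmulr_rge0 ?subr_ge0 // lt_neqAle eq_sym B_neq0.
Qed.

Section EuclideanNorm.
Context {R : realType}.
Implicit Types d : nat.

Lemma dotE d (u v : 'rV[R]_d) : (u *m v^T) 0 0 = \sum_j u 0 j * v 0 j.
Proof. by rewrite mxE; apply: eq_bigr => j _; rewrite mxE. Qed.

Lemma enorm_ge0 d (u : 'rV[R]_d) : 0 <= enorm u.
Proof. exact: sqrtr_ge0. Qed.

Lemma sqr_enorm d (u : 'rV[R]_d) : enorm u ^+ 2 = \sum_j u 0 j ^+ 2.
Proof. by rewrite sqr_sqrtr // sumr_ge0 // => j _; apply: sqr_ge0. Qed.

Lemma dotvv d (u : 'rV[R]_d) : (u *m u^T) 0 0 = enorm u ^+ 2.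
Proof. by rewrite dotE sqr_enorm; apply: eq_bigr => j _; rewrite expr2. Qed.

Lemma normr_dot_le d (u v : 'rV[R]_d) :
  `|(u *m v^T) 0 0| <= enorm u * enorm v.
Proof.
rewrite -ler_sqr ?nnegrE ?mulr_ge0 ?enorm_ge0 // real_normK ?num_real //.
by rewrite exprMn !sqr_enorm dotE sum_CauchySchwarz.
Qed.

Lemma dot_le d (u v : 'rV[R]_d) : (u *m v^T) 0 0 <= enorm u * enorm v.
Proof. exact: le_trans (ler_norm _) (normr_dot_le u v). Qed.

Lemma enorm_le d (u : 'rV[R]_d) (r : R) :
  0 <= r -> \sum_j u 0 j ^+ 2 <= r ^+ 2 -> enorm u <= r.
Proof. by move=> r0; rewrite -sqr_enorm ler_sqr ?nnegrE ?enorm_ge0. Qed.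

Lemma enormD d (u v : 'rV[R]_d) : enorm (u + v) <= enorm u + enorm v.
Proof.
apply: enorm_le; first by rewrite addr_ge0 ?enorm_ge0.
have -> : \sum_j (u + v) 0 j ^+ 2 =
    enorm u ^+ 2 + 2 * (u *m v^T) 0 0 + enorm v ^+ 2.
  rewrite !sqr_enorm dotE mulr_sumr -!big_split /=.
  by apply: eq_bigr => j _; rewrite mxE; ring.
by have := dot_le u v; rewrite sqrrD; lra.
Qed.

Lemma enormZ d (k : R) (u : 'rV[R]_d) : enorm (k *: u) = `|k| * enorm u.
Proof.
rewrite /enorm -sqrtr_sqr -sqrtrM ?sqr_ge0 // mulr_sumr.
by congr Num.sqrt; apply: eq_bigr => j _; rewrite mxE exprMn.
Qed.

Lemma enormN d (u : 'rV[R]_d) : enorm (- u) = enorm u.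
Proof. by rewrite -scaleN1r enormZ normrN1 mul1r. Qed.

Lemma enorm0 d : enorm (0 : 'rV[R]_d) = 0.
Proof. by rewrite -(scale0r 0) enormZ normr0 mul0r. Qed.

Lemma enormB d (u v : 'rV[R]_d) : enorm (u - v) <= enorm u + enorm v.
Proof. by rewrite -(enormN v) enormD. Qed.

Lemma enorm_sum d (I : finType) (u : I -> 'rV[R]_d) :
  enorm (\sum_i u i) <= \sum_i enorm (u i).
Proof.
elim/big_ind2: _ => [|x1 x2 y1 y2 h1 h2|//]; first by rewrite enorm0.
by apply: le_trans (enormD _ _) _; apply: lerD.
Qed.

Lemma sqr_enorm_row_mx d1 d2 (u : 'rV[R]_d1) (v : 'rV[R]_d2) :
  enorm (row_mx u v) ^+ 2 = enorm u ^+ 2 + enorm v ^+ 2.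
Proof.
rewrite !sqr_enorm big_split_ord /=.
by congr (_ + _); apply: eq_bigr => j _; rewrite ?row_mxEl ?row_mxEr.
Qed.

Lemma enorm_sub_mx d1 d2 (z : 'rV[R]_(d1 + d2)) :
  enorm z ^+ 2 = enorm (lsubmx z) ^+ 2 + enorm (rsubmx z) ^+ 2.
Proof. by rewrite -sqr_enorm_row_mx hsubmxK. Qed.

(** With [u = y *m M^T], the square of [|u|] is the scalar product of [u *m M] and [y], hence at
    most [k |u| |y|]; it remains to divide by [|u|]. *)
Lemma enorm_trmx d1 d2 (M : 'M[R]_(d1, d2)) (k : R) : 0 <= k ->
  (forall x, enorm (x *m M) <= k * enorm x) ->
  forall y, enorm (y *m M^T) <= k * enorm y.
Proof.
move=> k0 Mk y; set u := y *m M^T.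
have [->|u0] := eqVneq (enorm u) 0; first by rewrite mulr_ge0 ?enorm_ge0.
have u_gt0 : 0 < enorm u by rewrite lt_neqAle eq_sym u0 enorm_ge0.
rewrite -(ler_pM2l u_gt0) -expr2 -dotvv.
have -> : u *m u^T = (u *m M) *m y^T by rewrite /u trmx_mul trmxK !mulmxA.
apply: le_trans (dot_le _ _) _.
by rewrite mulrA ler_wpM2r ?enorm_ge0 // mulrC Mk.
Qed.

End EuclideanNorm.

(** * Bilinear payoffs *)

Lemma eq_ler (R : realType) (x y : R) : x = y -> x <= y.
Proof. by move=> ->. Qed.

Section BilinearCalculus.
Context {R : realType} {dx dy : nat}.
Implicit Types (M : 'M[R]_(dx, dy)) (c : 'rV[R]_dy) (z : 'rV[R]_(dx + dy)).

(** The linear term [c] sets the algorithm off: at zero memories the gradient in x vanishes, while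
    the gradient in y is [c]. *)
Definition bilinear_payoff M c z : R :=
  ((lsubmx z *m M + c) *m (rsubmx z)^T) 0 0.

Definition payoff_hessian M : 'M[R]_(dx + dy) := block_mx 0 M M^T 0.

Lemma bilinear_payoff_sum M c z : bilinear_payoff M c z =
  \sum_v (\sum_u z 0 (lshift dy u) * M u v + c 0 v) * z 0 (rshift dx v).
Proof.
rewrite /bilinear_payoff dotE; apply: eq_bigr => v _; rewrite !mxE.
by under eq_bigr do rewrite !mxE.
Qed.

Lemma differentiable_bilinear_payoff M c z :
  differentiable (bilinear_payoff M c) z.
Proof.
have -> : bilinear_payoff M c = \sum_v (\sum_u (M u v *: (fun z => z 0 (lshift dy u)))
    + cst (c 0 v)) * (fun z : 'rV[R]_(dx + dy) => z 0 (rshift dx v)).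
  apply/funext => w; rewrite bilinear_payoff_sum fct_sumE; apply: eq_bigr => v _.
  rewrite !fctE fct_sumE; congr ((_ + _) * _).
  by apply: eq_bigr => u _; rewrite mulrC.
apply: differentiable_sum => v; apply: differentiableM; last first.
  exact: differentiable_coord.
apply: differentiableD; last exact: differentiable_cst.
apply: differentiable_sum => u; apply: differentiableZ.
exact: differentiable_coord.
Qed.

Lemma derive_line (V W : normedModType R) (f : V -> W) (x v : V) :
  'D_v f x = 'D_1 (fun h : R => f (h *: v + x)) 0.
Proof.
rewrite /derive; set g1 := fun h => h^-1 *: _; set g2 := fun h => h^-1 *: _.
suff -> : g1 = g2 by [].
by rewrite funeqE /g1 /g2 => h /=; rewrite addr0 scale0r add0r [_%:A]mulr1.
Qed.

Lemma derive_bilinear_payoff M c z w : 'D_w (bilinear_payoff M c) z =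
  ((lsubmx z *m M + c) *m (rsubmx w)^T + (lsubmx w *m M) *m (rsubmx z)^T) 0 0.
Proof.
set A := RHS; pose B := ((lsubmx w *m M) *m (rsubmx w)^T) 0 0.
(* Along a line the payoff is a quadratic polynomial in [h], whose linear coefficient is the
   derivative. *)
have line h : bilinear_payoff M c (h *: w + z) =
    bilinear_payoff M c z + A * h + B * h ^+ 2.
  rewrite /bilinear_payoff /A /B !(linearD, linearZ) /=.
  rewrite [(_ + _) *m M]mulmxDl -[(_ *: _) *m M]scalemxAl.
  rewrite -addrA; move: (lsubmx z *m M + c) (lsubmx w *m M) => a b.
  move: (rsubmx z)^T (rsubmx w)^T => p q.
  rewrite !(mulmxDl, mulmxDr) -!(scalemxAl, scalemxAr).
  move: (b *m q) (b *m p) (a *m q) (a *m p) => B1 B2 B3 B4; rewrite !mxE; ring.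
rewrite derive_line.
under eq_fun do rewrite line.
by rewrite derive_val !scale0r addr0 scaler0 addr0 add0r mul1r [_%:A]mulr1.
Qed.

Lemma gradient_bilinear_payoff M c z : gradient (bilinear_payoff M c) z =
  z *m payoff_hessian M + row_mx 0 c.
Proof.
apply/rowP => j; rewrite mxE derive_bilinear_payoff.
rewrite -[in RHS](hsubmxK z) mul_row_block !mulmx0 addr0 add0r add_row_mx addr0.
case: (splitP j) => k jk.
  have -> : j = lshift dy k by exact/val_inj.
  have -> : lsubmx (delta_mx 0 (lshift dy k)) = delta_mx 0 k :> 'rV[R]_dx.
    by apply/rowP => i; rewrite !mxE.
  have -> : rsubmx (delta_mx 0 (lshift dy k)) = 0 :> 'rV[R]_dy.
    by apply/rowP => i; rewrite !mxE eq_rlshift andbF.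
  rewrite row_mxEl linear0 mulmx0 add0r -rowE dotE !mxE.
  by apply: eq_bigr => i _; rewrite !mxE mulrC.
have -> : j = rshift dx k by exact/val_inj.
have -> : lsubmx (delta_mx 0 (rshift dx k)) = 0 :> 'rV[R]_dx.
  by apply/rowP => i; rewrite !mxE eq_lrshift andbF.
have -> : rsubmx (delta_mx 0 (rshift dx k)) = delta_mx 0 k :> 'rV[R]_dy.
  by apply/rowP => i; rewrite !mxE eq_rshift.
by rewrite row_mxEr !mul0mx addr0 trmx_delta -colE mxE.
Qed.

Lemma mulmxr_continuous m n (H : 'M[R]_(m, n)) :
  continuous (mulmxr H : 'rV[R]_m -> 'rV[R]_n).
Proof.
move=> w; apply: differentiable_continuous.
have -> : mulmxr H = \sum_i (fun z : 'rV[R]_m => z 0 i *: row i H).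
  by apply/funext => v /=; rewrite mulmx_sum_row fct_sumE.
apply: differentiable_sum => i; apply: differentiableZl.
exact: differentiable_coord.
Qed.

Lemma differentiable_affine m n (H : 'M[R]_(m, n)) (g : 'rV[R]_n) (z : 'rV[R]_m) :
  differentiable (fun z : 'rV[R]_m => z *m H + g) z.
Proof.
apply: (@differentiableD _ _ _ (mulmxr H) (cst g)); last exact: differentiable_cst.
apply: linear_differentiable; exact: mulmxr_continuous.
Qed.

Lemma jacobian_affine m n (H : 'M[R]_(m, n)) (g : 'rV[R]_n) (z : 'rV[R]_m) :
  'J (fun z : 'rV[R]_m => z *m H + g) z = H.
Proof.
apply/row_matrixP => i; rewrite !rowE /jacobian mul_rV_lin1 /=.
rewrite -deriveE; last exact: differentiable_affine.
rewrite derive_line.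
have -> : (fun h : R => (h *: delta_mx 0 i + z) *m H + g) =
    (fun h : R => h *: (delta_mx 0 i *m H) + (z *m H + g)).
  by apply/funext => h; rewrite mulmxDl -scalemxAl addrA.
set w := delta_mx 0 i *m H; set b := z *m H + g.
have dF : is_diff (0 : R) (fun h : R => h *: w + b) ( *:%R^~ w + 0).
  exact: is_diffD.
rewrite deriveE; last exact: ex_diff.
by rewrite diff_val /= !fctE addr0 scale1r.
Qed.

Lemma hessian_bilinear_payoff M c z :
  hessian (bilinear_payoff M c) z = payoff_hessian M.
Proof.
rewrite /hessian.
have -> : gradient (bilinear_payoff M c) =
    (fun z => z *m payoff_hessian M + row_mx 0 c).
  by apply/funext => w; apply: gradient_bilinear_payoff.
exact: jacobian_affine.
Qed.

Lemma twice_differentiable_bilinear_payoff M c :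
  twice_differentiable (bilinear_payoff M c).
Proof.
move=> z; split; first exact: differentiable_bilinear_payoff.
have -> : gradient (bilinear_payoff M c) =
    (fun z => z *m payoff_hessian M + row_mx 0 c).
  by apply/funext => w; apply: gradient_bilinear_payoff.
exact: differentiable_affine.
Qed.

Lemma gradient_x_bilinear_payoff M c x y :
  gradient_x (bilinear_payoff M c) x y = y *m M^T.
Proof.
rewrite /gradient_x gradient_bilinear_payoff mul_row_block !mulmx0 add0r addr0.
by rewrite add_row_mx addr0 row_mxKl.
Qed.

Lemma gradient_y_bilinear_payoff M c x y :
  gradient_y (bilinear_payoff M c) x y = x *m M + c.
Proof.
rewrite /gradient_y gradient_bilinear_payoff mul_row_block !mulmx0 add0r addr0.
by rewrite add_row_mx row_mxKr.
Qed.

(** The gradient field is affine, with linear part sending (x, y) to (y M^T, - x M). Each block is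
    bounded separately and the squared norms add up. *)
Lemma L_smooth_bilinear_payoff M c (L : R) : 0 <= L ->
  (forall x, enorm (x *m M) <= L * enorm x) ->
  L_smooth L (bilinear_payoff M c).
Proof.
move=> L0 ML; split=> [z|z1 z2]; first exact: differentiable_bilinear_payoff.
rewrite /gradient_field !gradient_x_bilinear_payoff !gradient_y_bilinear_payoff.
have -> : row_mx (rsubmx z1 *m M^T) (- (lsubmx z1 *m M + c)) -
    row_mx (rsubmx z2 *m M^T) (- (lsubmx z2 *m M + c)) =
    row_mx (rsubmx (z1 - z2) *m M^T) (- (lsubmx (z1 - z2) *m M)).
  rewrite opp_row_mx add_row_mx !linearB !mulmxBl /=; congr row_mx.
  by rewrite opprK !opprD addrACA addNr addr0 opprK.
move: (z1 - z2) => z.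
rewrite -ler_sqr ?nnegrE ?mulr_ge0 ?enorm_ge0 // exprMn.
rewrite sqr_enorm_row_mx enormN (enorm_sub_mx z) mulrDr addrC -!exprMn.
by apply: lerD; rewrite ler_sqr ?nnegrE ?mulr_ge0 ?enorm_ge0 // enorm_trmx.
Qed.

Lemma spectral_norm_payoff_hessian M (k : R) : 0 <= k ->
  (forall x, enorm (x *m M) <= k * enorm x) ->
  spectral_norm (payoff_hessian M) <= k.
Proof.
move=> k0 Mk; apply: ge_sup.
  by exists (enorm ((0 : 'rV[R]_(dx + dy)) *m payoff_hessian M)), 0; rewrite //= enorm0.
move=> _ [z /= z1 <-].
rewrite -ler_sqr ?nnegrE ?enorm_ge0 //.
rewrite -[z]hsubmxK mul_row_block !mulmx0 add0r addr0 sqr_enorm_row_mx.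
apply: (@le_trans _ _ ((k * enorm z) ^+ 2)).
  rewrite exprMn (enorm_sub_mx z) mulrDr addrC -!exprMn.
  by apply: lerD; rewrite ler_sqr ?nnegrE ?mulr_ge0 ?enorm_ge0 // enorm_trmx.
by rewrite ler_sqr ?nnegrE ?mulr_ge0 ?enorm_ge0 // ler_piMr.
Qed.

(** The payoff is affine in each variable separately, so both convexity inequalities are
    equalities. *)
Lemma convex_concave_bilinear_payoff M c :
  convex_concave (bilinear_payoff M c).
Proof.
split=> [y|x] t u v _ _; apply: (@eq_ler R); set k : R := t%:num.
  have -> : conv t u v = k *: (u : 'rV[R]_dx) + (1 - k) *: (v : 'rV[R]_dx) by [].
  rewrite convRE -/k; set l := unstable.onem k; have -> : l = 1 - k by [].
  rewrite /bilinear_payoff !row_mxKl !row_mxKr !mulmxDl -!scalemxAl !mxE; ring.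
have -> : conv t u v = k *: (u : 'rV[R]_dy) + (1 - k) *: (v : 'rV[R]_dy) by [].
rewrite convRE -/k; set l := unstable.onem k; have -> : l = 1 - k by [].
rewrite /bilinear_payoff !row_mxKl !row_mxKr !linearD !linearZ /= !mxE; ring.
Qed.

Lemma average_bilinear_payoff n (M : 'I_n -> 'M[R]_(dx, dy))
    (c : 'I_n -> 'rV[R]_dy) :
  average (fun i => bilinear_payoff (M i) (c i)) =
  bilinear_payoff (n%:R^-1 *: \sum_i M i) (n%:R^-1 *: \sum_i c i).
Proof.
apply/funext => z; rewrite /average /bilinear_payoff.
rewrite -scalemxAr mulmx_sumr -scalerDr -big_split /= -scalemxAl mulmx_suml.
by rewrite mxE summxE.
Qed.

(** Hessians are constant and linear in the matrix, so only the deviation of [M i] from the mean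
    matrix matters. *)
Lemma second_order_similarity_bilinear_payoff (delta : R) n
    (M : 'I_n -> 'M[R]_(dx, dy)) (c : 'I_n -> 'rV[R]_dy) : 0 <= delta ->
  (forall i x, enorm (x *m (M i - n%:R^-1 *: \sum_k M k)) <= delta * enorm x) ->
  second_order_similarity delta (fun i => bilinear_payoff (M i) (c i)).
Proof.
move=> d0 Md; split=> [i|i z]; first exact: twice_differentiable_bilinear_payoff.
rewrite average_bilinear_payoff !hessian_bilinear_payoff.
rewrite /payoff_hessian opp_block_mx add_block_mx !oppr0 !addr0 -linearB /=.
exact: spectral_norm_payoff_hessian.
Qed.

End BilinearCalculus.

(** * Words *)

Section Words.
Context {q : nat}.
Implicit Types (w t c : seq 'I_q).

Fixpoint words k : seq (seq 'I_q) :=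
  if k is k'.+1 then [seq j :: w | j <- enum 'I_q, w <- words k'] else [:: [::]].

(** These are the vertices of the tree, level by level. The root [[::]] is left out because it
    carries a constant, not a variable. *)
Fixpoint tree_words N : seq (seq 'I_q) :=
  if N is N'.+1 then tree_words N' ++ words N else [::].

Lemma size_words k : size (words k) = (q ^ k)%N.
Proof. by elim: k => //= k IHk; rewrite size_allpairs IHk size_enum_ord expnS. Qed.

Lemma mem_words k w : (w \in words k) = (size w == k).
Proof.
elim: k w => [|k IHk] [|j w] //=.
  by apply/negbTE/negP => /allpairsP[[i v] []].
rewrite eqSS -IHk; apply/allpairsP/idP => [[[i v] /= [_ vk [_ ->]]]|wk] //.
by exists (j, w); rewrite mem_enum.
Qed.

Lemma uniq_words k : uniq (words k).
Proof.
elim: k => //= k IHk; apply: allpairs_uniq => //; first exact: enum_uniq.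
by move=> [i v] [j w] _ _ /= [-> ->].
Qed.

Lemma mem_tree_words N w : (w \in tree_words N) = (0 < size w <= N)%N.
Proof.
elim: N => [|N IHN]; first by case: w.
rewrite mem_cat IHN mem_words (leq_eqVlt _ N.+1) ltnS andb_orr orbC.
by case: eqVneq => [->|_]; rewrite ?andbF ?ltnS ?leq0n /=.
Qed.

Lemma uniq_tree_words N : uniq (tree_words N).
Proof.
elim: N => // N IHN; rewrite cat_uniq IHN uniq_words andbT /=.
apply/hasPn => w wN; rewrite mem_tree_words.
by have := mem_words N.+1 w; rewrite wN => /esym/eqP ->; rewrite ltnn andbF.
Qed.

Lemma size_tree_words_gt0 N : (0 < q)%N -> (0 < N)%N ->
  (0 < size (tree_words N))%N.
Proof.
by case: N => // N q0 _; rewrite size_cat size_words ltn_addl // expn_gt0 q0.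
Qed.

Section Sums.
Context {V : nmodType} (g : seq 'I_q -> V).

Lemma sum_wordsS k (h : seq 'I_q -> V) : \sum_(w <- words k.+1) h w =
  \sum_(j < q) \sum_(w <- words k) h (j :: w).
Proof. by rewrite big_allpairs_dep big_enum. Qed.

(** Every word of length [k] is the suffix of exactly [q ^ i] words of length [i + k]. *)
Lemma sum_words_drop i k :
  \sum_(t <- words (i + k)) g (drop i t) = (\sum_(w <- words k) g w) *+ q ^ i.
Proof.
elim: i => [|i IHi]; first by under eq_bigr do rewrite drop0.
by rewrite addSn sum_wordsS /= sumr_const card_ord IHi -mulrnA expnSr.
Qed.

Lemma sum_tree_words N :
  \sum_(w <- tree_words N) g w = \sum_(k < N) \sum_(w <- words k.+1) g w.
Proof.
elim: N => [|N IHN]; first by rewrite big_nil big_ord0.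
by rewrite big_ord_recr /= big_cat IHN.
Qed.

End Sums.

(** This is a generating function bound: the number of distinct subwords of length [k] obeys a
    Pascal recurrence in [c], as an inequality. The weight [a] is left free, to be optimised
    later. *)
Lemma count_subseq_words (R : realFieldType) (a : R) k c : 0 <= a ->
  (\sum_(w <- words k) (subseq w c)%:R) * a ^+ k <= (1 + a) ^+ size c.
Proof.
move=> a0; elim: c k => [|y c IHc] [|k].
- by rewrite big_seq1 /= expr0 mulr1.
- rewrite sum_wordsS big1 ?mul0r ?exprn_ge0 ?addr_ge0 // => j _.
  by rewrite big1.
- by rewrite big_seq1 sub0seq expr0 mulr1 exprn_ege1 // lerDl.
apply: (@le_trans _ _
  ((\sum_(w <- words k) (subseq w c)%:R + \sum_(w <- words k.+1) (subseq w c)%:R)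
   * a ^+ k.+1)).
  rewrite ler_wpM2r ?exprn_ge0 // !sum_wordsS.
  rewrite (bigD1 y isT) [X in _ <= _ + X](bigD1 y isT) /=; under eq_bigr do rewrite eqxx.
  (* Words starting with [y] only need their tail inside [c]; all others must lie inside [c]
     themselves. *)
  rewrite lerD // -[leLHS]add0r lerD ?sumr_ge0 //; apply: ler_sum => j jy.
  by rewrite (negbTE jy).
rewrite mulrDl {1}exprS mulrCA /= [(1 + a) ^+ _]exprS mulrDl mul1r addrC.
by apply: lerD; [exact: (IHc k.+1)|rewrite ler_wpM2l].
Qed.

End Words.

Lemma expR1_le4 (R : realType) : expR 1 <= 4 :> R.
Proof.
have h : 2^-1 <= expR (- 2^-1) :> R.
  by apply: le_trans (expR_ge1Dx _); lra.
rewrite -[X in expR X]opprK expRN -[leRHS]invrK lef_pV2 ?posrE ?expR_gt0 ?invr_gt0 //.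
have -> : -1 = - 2^-1 + - 2^-1 :> R by lra.
have -> : 4^-1 = 2^-1 * 2^-1 :> R by lra.
by rewrite expRD ler_pM.
Qed.

(** With the weight [32 / q], the generating function is at most
    [exp (32 * size c / q) <= exp N <= 4 ^ N]. So the count is at most
    [(4 * q / 32) ^ N = (q / 8) ^ N], and one factor 1/8 is enough. *)
Lemma few_subseq_words (R : realType) q N (c : seq 'I_q) :
  (0 < q)%N -> (0 < N)%N -> (32 * size c <= q * N)%N ->
  \sum_(w <- words N) (subseq w c)%:R <= (q ^ N)%:R / 8 :> R.
Proof.
move=> q0 N0 cN; set S := \sum_(w <- _) _.
have qR : 0 < q%:R :> R by rewrite ltr0n.
have := count_subseq_words N c (_ : 0 <= 32 / q%:R :> R).
rewrite -/S => /(_ (divr_ge0 _ _)) h.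
have {h} : S * (32 / q%:R) ^+ N <= 4 ^+ N.
  apply: le_trans (h _ _) _ => //.
  apply: (@le_trans _ _ (expR (32 / q%:R) ^+ size c)).
    by rewrite lerXn2r ?nnegrE ?expR_ge0 ?expR_ge1Dx // addr_ge0 // divr_ge0.
  apply: (@le_trans _ _ (expR 1 ^+ N)).
    rewrite -!expRM_natl ler_expR mulr1 mulrA ler_pdivrMr //.
    by rewrite -!natrM ler_nat mulnC (mulnC N).
  by rewrite lerXn2r ?nnegrE ?expR_ge0 // expR1_le4.
have -> : 32 = 4 * 8 :> R by rewrite -natrM.
rewrite -mulrA exprMn [S * _]mulrCA ger_pMr ?exprn_gt0 // expr_div_n mulrA.
rewrite ler_pdivrMr ?exprn_gt0 // mul1r -(natrX _ q) => h.
rewrite ler_pdivlMr //; apply: le_trans h.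
rewrite ler_wpM2l ?sumr_ge0 //.
by rewrite -[leLHS]expr1 ler_eXn2l // ltr1n.
Qed.

(* Along the suffixes of a word [t] at which [X] vanishes, the residuals
   telescope to [X [::]]; averaging the Cauchy-Schwarz inequality over all words
   counts every residual once. *)
Lemma words_residual (R : realType) q N (X : seq 'I_q -> R) (s : R)
    (E : pred (seq 'I_q)) :
  (0 < q)%N -> X [::] = s -> (forall t, size t = N -> E t -> X t = 0) ->
  (\sum_(t <- words N) (E t)%:R) * s ^+ 2 <=
  (q ^ N)%:R * (N%:R * \sum_(w <- tree_words N)
     (X (behead w) / Num.sqrt q%:R - X w) ^+ 2).
Proof.
move=> q0 Xs XE; set b := Num.sqrt q%:R : R.
have b0 : 0 < b by rewrite sqrtr_gt0 ltr0n.
have b2 : b ^+ 2 = q%:R by rewrite sqr_sqrtr.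
pose r w := X (behead w) / b - X w.
have path t : size t = N -> (E t)%:R * s ^+ 2 <=
    N%:R * \sum_(i < N) q%:R ^+ (N - i) * r (drop i t) ^+ 2.
  move=> tN; case: (boolP (E t)) => [Et|_]; last first.
    rewrite mul0r mulr_ge0 // sumr_ge0 // => i _.
    by apply: mulr_ge0; rewrite ?sqr_ge0 ?exprn_ge0 ?ler0n.
  (* The weight makes [Y i.+1 - Y i] the residual at [drop i t] times [b ^+ (N - i)]; the endpoints
     are [Y 0 = 0] and [Y N = s]. *)
  pose Y i := b ^+ (N - i) * X (drop i t).
  have -> : s = \sum_(i < N) 1 * (b ^+ (N - i) * r (drop i t)).
    have : \sum_(0 <= i < N) (Y i.+1 - Y i) = Y N - Y 0%N.
      by apply: telescope_sumr.
    have -> : Y N = s by rewrite /Y subnn mul1r drop_oversize ?tN.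
    have -> : Y 0%N = 0 by rewrite /Y drop0 XE ?mulr0.
    rewrite subr0.
    move=> <-; rewrite big_mkord; apply: eq_bigr => i _; rewrite mul1r /Y /r.
    have -> : behead (drop i t) = drop i.+1 t by rewrite -drop1 drop_drop.
    have -> : (N - i = (N - i.+1).+1)%N by rewrite -subSn.
    by rewrite exprSr mulrBr mulrA mulrC; field; rewrite gt_eqF.
  rewrite mul1r; apply: le_trans (sum_CauchySchwarz _ _) _.
  rewrite expr1n sumr_const card_ord; apply: eq_ler; congr (_ * _).
  by apply: eq_bigr => i _; rewrite exprMn -b2 exprAC.
rewrite mulr_suml.
apply: (@le_trans _ _ (\sum_(t <- words N)
   N%:R * \sum_(i < N) q%:R ^+ (N - i) * r (drop i t) ^+ 2)).
  rewrite big_seq [leRHS]big_seq; apply: ler_sum => t.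
  by rewrite mem_words => /eqP; apply: path.
apply: eq_ler; rewrite -mulr_sumr [RHS]mulrCA; congr (_ * _).
rewrite exchange_big /= sum_tree_words mulr_sumr.
(* Reversal indexes the suffixes by their length [i.+1]: the weight [q ^ i.+1] times the
   multiplicity [q ^ (N - i.+1)] is [q ^ N] at every level. *)
rewrite (reindex_inj rev_ord_inj); apply: eq_bigr => i _ /=.
have iN : (N - (N - i.+1) = i.+1)%N by rewrite subKn.
rewrite iN -mulr_sumr.
have -> : words N = words ((N - i.+1) + i.+1) by rewrite subnK.
rewrite (sum_words_drop (fun w => r w ^+ 2)) -[X in _ * X = _]mulr_natl mulrA.
by rewrite -natrX -natrM -expnD subnKC.
Qed.

(** * Gap over balls *)

Section GapBalls.
Context {R : realType} {dx dy : nat}.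

Definition eball d (r : R) : set 'rV[R]_d := [set u | enorm u <= r].

(** Against [x], the best [y'] in the ball is aligned with [x *m M + c] and earns [r] times its
    norm. Against any [y], the point [x0] cancels the coupling and brings the minimum down to at
    most 0. *)
Lemma Gap_bilinear_payoff_ge (M : 'M[R]_(dx, dy)) (c : 'rV[R]_dy) (r : R)
    (x0 x : 'rV[R]_dx) (y : 'rV[R]_dy) :
  enorm x0 <= r -> x0 *m M + c = 0 ->
  r * enorm (x *m M + c) <=
    Gap (bilinear_payoff M c) (@eball dx r) (@eball dy r) x y.
Proof.
move=> x0r x0M; have r0 : 0 <= r := le_trans (enorm_ge0 _) x0r.
have payoff x' y' : bilinear_payoff M c (row_mx x' y') = ((x' *m M + c) *m y'^T) 0 0.
  by rewrite /bilinear_payoff row_mxKl row_mxKr.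
rewrite /Gap -[leLHS]subr0; apply: lerB.
  set g := x *m M + c; set k := enorm g.
  have [y' y'r <-] : exists2 y', enorm y' <= r & (g *m y'^T) 0 0 = r * k.
    have [k0|k0] := eqVneq k 0.
      by exists 0; rewrite ?enorm0 // linear0 mulmx0 mxE k0 mulr0.
    exists ((r / k) *: g).
      by rewrite enormZ -/k ger0_norm ?divr_ge0 ?enorm_ge0 // divfK.
    by rewrite linearZ /= -scalemxAr mxE dotvv -/k expr2; field.
  apply: ub_le_sup; last by exists y' => //; rewrite payoff.
  exists (k * r) => _ [y'' y''r <-]; rewrite payoff.
  by apply: le_trans (dot_le _ _) _; rewrite ler_wpM2l ?enorm_ge0.
apply: ge_inf; last by exists x0 => //; rewrite payoff x0M mul0mx mxE.
(* The infimum is below the value at [x0] only once the payoffs are known to be bounded below;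
   Cauchy-Schwarz gives this bound. *)
exists (- (r * enorm (y *m M^T)) + (c *m y^T) 0 0) => _ [x' x'r <-].
rewrite payoff mulmxDl [X in _ <= X]mxE lerD2r.
have -> : x' *m M *m y^T = x' *m (y *m M^T)^T by rewrite trmx_mul trmxK mulmxA.
rewrite lerNl; apply: le_trans (ler_norm _) _; rewrite normrN.
by apply: le_trans (normr_dot_le _ _) _; rewrite ler_wpM2r ?enorm_ge0.
Qed.

Lemma continuous_enorm d : continuous (fun u : 'rV[R]_d => enorm u).
Proof.
have dsum : continuous (\sum_j ((fun u : 'rV[R]_d => u 0 j) ^+ 2)).
  move=> u; apply: differentiable_continuous; apply: differentiable_sum => j.
  by apply: differentiableX; apply: differentiable_coord.
move=> u; apply: (@continuous_comp _ _ _ _ Num.sqrt); last exact: sqrt_continuous.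
have -> : (fun v : 'rV[R]_d => \sum_j v 0 j ^+ 2) =
   \sum_j ((fun u : 'rV[R]_d => u 0 j) ^+ 2).
  by apply/funext => v; rewrite fct_sumE.
exact: dsum.
Qed.

Lemma closed_product_eball (r : R) :
  closed (product_set (@eball dx r) (@eball dy r)).
Proof.
have cl d (g : 'rV[R]_(dx + dy) -> 'rV[R]_d) : continuous g ->
    closed [set z | enorm (g z) <= r].
  move=> g_cont.
  have /continuous_closedP cl : continuous (@enorm R d \o g).
    by move=> z; apply: continuous_comp; [exact: g_cont|exact: continuous_enorm].
  exact: cl _ (@closed_le _ r).
by apply: closedI; apply: cl; [exact: continuous_lsubmx|exact: continuous_rsubmx].
Qed.

Lemma convex_product_eball (r : R) :
  convex_set (product_set (@eball dx r) (@eball dy r)).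
Proof.
move=> u v t; rewrite !inE => -[u1 u2] [v1 v2]; set k : R := t%:num.
have -> : conv t u v = k *: (u : 'rV[R]_(dx + dy)) + (1 - k) *: (v : 'rV[R]_(dx + dy)).
  by [].
have k0 : 0 <= k by rewrite /k ge0.
have k1 : k <= 1 by rewrite /k le1.
have conv_ball d (x y : 'rV[R]_d) : enorm x <= r -> enorm y <= r ->
    enorm (k *: x + (1 - k) *: y) <= r.
  move=> xr yr; apply: le_trans (enormD _ _) _; rewrite !enormZ.
  rewrite !ger0_norm ?subr_ge0 //.
  apply: (@le_trans _ _ (k * r + (1 - k) * r)); last by apply: eq_ler; ring.
  by apply: lerD; apply: ler_wpM2l; rewrite ?subr_ge0.
by split; rewrite /eball /= !linearD !linearZ; apply: conv_ball.
Qed.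

(** Each ball contributes at most [(2 * r) ^+ 2] to the squared distance, whence the factor 8. *)
Lemma diameter_product_eball (r D : R) : 0 <= D -> 8 * r ^+ 2 <= D ^+ 2 ->
  has_diameter D (product_set (@eball dx r) (@eball dy r)).
Proof.
move=> D0 rD u v [u1 u2] [v1 v2].
have ball2 d (x y : 'rV[R]_d) : enorm x <= r -> enorm y <= r ->
    enorm (x - y) ^+ 2 <= 4 * r ^+ 2.
  move=> xr yr; have r0 := le_trans (enorm_ge0 _) xr.
  have -> : 4 * r ^+ 2 = (r + r) ^+ 2 by ring.
  rewrite ler_sqr ?nnegrE ?addr_ge0 ?enorm_ge0 //.
  by apply: le_trans (enormB _ _) _; apply: lerD.
rewrite -ler_sqr ?nnegrE ?enorm_ge0 // enorm_sub_mx !linearB.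
apply: le_trans rD; have := ball2 _ _ _ u1 v1; have := ball2 _ _ _ u2 v2.
by rewrite /=; lra.
Qed.

End GapBalls.

(** * The tree game *)

Section TreeInstance.
Context {R : realType} {q n : nat} (N : nat) (l : 'I_n -> 'I_q) (a s : R).

Local Notation d := (size (@tree_words q N)).
Local Notation b := (Num.sqrt (q%:R : R)).

Definition word (j : 'I_d) : seq 'I_q := nth [::] (tree_words N) j.

(** Acting on row vectors, this moves the coordinate of [w] to [l i :: w]; the last level, of words
    of length [N], is dropped. *)
Definition shift_mx (i : 'I_n) : 'M[R]_d :=
  \matrix_(u, v) (word v == l i :: word u)%:R.

Definition tree_mx (i : 'I_n) : 'M[R]_d := a *: (shift_mx i - b^-1 *: 1%:M).

Definition tree_source (i : 'I_n) : 'rV[R]_d :=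
  \row_v (a * s * (word v == [:: l i])%:R).

(** This extends [x] to all words: [s] at the root and 0 beyond length [N]. The sum has at most one
    term, which avoids looking up the index of [w]. *)
Definition tree_fun (x : 'rV[R]_d) (w : seq 'I_q) : R :=
  if w is [::] then s else \sum_(u | word u == w) x 0 u.

Lemma word_inj : injective word.
Proof.
move=> u v /eqP; rewrite nth_uniq ?uniq_tree_words // => /eqP; exact: val_inj.
Qed.

Lemma size_word u : (0 < size (word u) <= N)%N.
Proof. by rewrite -mem_tree_words mem_nth. Qed.

Lemma sum_word (g : seq 'I_q -> R) :
  \sum_v g (word v) = \sum_(w <- tree_words N) g w.
Proof. by rewrite [RHS](big_nth [::]) big_mkord. Qed.

Lemma tree_fun_word x v : tree_fun x (word v) = x 0 v.
Proof.
have := size_word v; rewrite /tree_fun; case E : (word v) => [//|j w] _.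
by rewrite -E (eq_bigl (pred1 v)) ?big_pred1_eq // => u; rewrite (inj_eq word_inj).
Qed.

(** Since [tree_fun] includes the root, the source becomes the shift of the root, and all levels
    obey the same formula. *)
Lemma tree_payoff_coord i x v : (x *m tree_mx i + tree_source i) 0 v =
  a * ((ohead (word v) == Some (l i))%:R * tree_fun x (behead (word v)) -
       tree_fun x (word v) / b).
Proof.
rewrite tree_fun_word -scalemxAr mulmxBr -scalemxAr mulmx1 !mxE.
under eq_bigr do rewrite mxE.
have := size_word v; case: (word v) => [//|j w] _ /=.
have -> : (Some j == Some (l i)) = (j == l i) by [].
under eq_bigr do rewrite eqseq_cons.
rewrite eqseq_cons; case: eqVneq => [_|_] /=; last first.
  rewrite big1 => [|u _]; last by rewrite mulr0.
  by ring.
rewrite /tree_fun; case: w => [|k w].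
  rewrite big1 => [|u _]; last first.
    by have := size_word u; case: (word u) => // k t _; rewrite mulr0.
  by rewrite /=; ring.
rewrite [in RHS]big_mkcond /=.
under eq_bigr do rewrite eq_sym mulr_natr mulrb.
by rewrite !mulr0; ring.
Qed.

(** Prepending a fixed letter is injective, so each row and each column has at most one nonzero
    entry. *)
Lemma enorm_shift_mx i x : enorm (x *m shift_mx i) <= enorm x.
Proof.
apply: enorm_le (enorm_ge0 _) _; rewrite sqr_enorm.
have coord v : (x *m shift_mx i) 0 v ^+ 2 =
    \sum_u x 0 u ^+ 2 * (word v == l i :: word u)%:R.
  rewrite mxE; under eq_bigr do rewrite mxE.
  case: (pickP (fun u => word v == l i :: word u)) => [u0 /eqP vu|nou]; last first.
    by rewrite !big1 ?expr0n // => u _; rewrite nou mulr0.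
  have off u : u != u0 -> (word v == l i :: word u) = false.
    by rewrite vu eqseq_cons eqxx /= (inj_eq word_inj) eq_sym => /negbTE.
  rewrite (bigD1 u0) //= [in RHS](bigD1 u0) //= vu eqxx !mulr1 -vu.
  by rewrite !big1 ?addr0 // => u /off ->; rewrite mulr0.
under eq_bigr do rewrite coord.
rewrite exchange_big; apply: ler_sum => u _; rewrite -mulr_sumr ler_piMr ?sqr_ge0 //.
rewrite /= (sum_word (fun w => (w == l i :: word u)%:R)) -natr_sum.
rewrite (eq_bigr (fun w => if w == l i :: word u then 1 else 0)%N); last first.
  by move=> w _; case: eqP.
by rewrite -big_mkcond sum1_count count_uniq_mem ?uniq_tree_words // lern1 leq_b1.
Qed.

Lemma enorm_tree_mx i x : 0 <= a -> (0 < q)%N ->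
  enorm (x *m tree_mx i) <= 2 * a * enorm x.
Proof.
move=> a0 q0; rewrite -scalemxAr enormZ ger0_norm //.
have -> : 2 * a * enorm x = a * (enorm x + enorm x) by ring.
rewrite ler_wpM2l // mulmxBr; apply: le_trans (enormB _ _) _.
rewrite -scalemxAr mulmx1 enormZ; apply: lerD.
  exact: enorm_shift_mx.
rewrite ler_piMl ?enorm_ge0 // ger0_norm ?invr_ge0 ?sqrtr_ge0 //.
by rewrite invf_le1 ?sqrtr_gt0 ?ltr0n // -[leLHS]sqrtr1 ler_wsqrtr // ler1n.
Qed.

(** The multiples of the identity cancel, leaving [a] times the difference of two contractions, a
    shift and the mean of the shifts. *)
Lemma enorm_tree_mx_average i x : 0 <= a -> (0 < n)%N ->
  enorm (x *m (tree_mx i - n%:R^-1 *: \sum_k tree_mx k)) <= 2 * a * enorm x.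
Proof.
move=> a0 n0; have nR : n%:R != 0 :> R by rewrite pnatr_eq0 -lt0n.
have -> : tree_mx i - n%:R^-1 *: (\sum_k tree_mx k) =
    a *: (shift_mx i - n%:R^-1 *: \sum_k shift_mx k).
  rewrite /tree_mx -scaler_sumr scalerA mulrC -scalerA -scalerBr; congr (_ *: _).
  rewrite sumrB sumr_const card_ord scalerBr -(scaler_nat n (b^-1 *: 1%:M)).
  by rewrite [_ *: (n%:R *: _)]scalerA mulVf // scale1r opprB addrA subrK.
rewrite -scalemxAr enormZ ger0_norm //.
have -> : 2 * a * enorm x = a * (enorm x + enorm x) by ring.
rewrite ler_wpM2l // mulmxBr; apply: le_trans (enormB _ _) _.
apply: lerD; first exact: enorm_shift_mx.
rewrite -scalemxAr mulmx_sumr enormZ ger0_norm ?invr_ge0 ?ler0n //.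
rewrite ler_pdivrMl ?ltr0n //.
apply: le_trans (enorm_sum _) _.
apply: (@le_trans _ _ (\sum_(k < n) enorm x)).
  by apply: ler_sum => k _; apply: enorm_shift_mx.
by rewrite sumr_const card_ord mulr_natl.
Qed.

(** Here [c] will be the word of the gradient calls made so far; only its subwords can carry nonzero
    coordinates. *)
Definition tree_supported (c : seq 'I_q) : set 'rV[R]_d :=
  [set x | forall v, ~~ subseq (word v) c -> x 0 v = 0].

Lemma tree_supported_sub c c' : subseq c c' ->
  tree_supported c `<=` tree_supported c'.
Proof.
move=> cc' x xc v; apply: contraNeq => /eqP xv; apply: contraT => vc'.
exfalso; apply: xv; apply: xc; apply: contra vc' => vc; exact: subseq_trans cc'.
Qed.

Lemma tree_supported_span c (us : seq 'rV[R]_d) v :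
  (forall u, u \in us -> tree_supported c u) -> v \in <<us>>%VS ->
  tree_supported c v.
Proof.
move=> usc /(@coord_span _ _ _ (in_tuple us)) -> w wc; rewrite summxE big1 // => i _.
by rewrite mxE usc ?mulr0 // mem_nth.
Qed.

(** A coordinate that becomes nonzero is that of [l i :: w] with [w] a subword of [c], the root
    included. *)
Lemma tree_supported_grad_y c i x : tree_supported c x ->
  tree_supported (l i :: c) (x *m tree_mx i + tree_source i).
Proof.
move=> xc v vc; rewrite tree_payoff_coord tree_fun_word.
have sub0 : ~~ subseq (word v) c.
  by apply: contra vc => /subseq_trans; apply; apply: subseq_cons.
rewrite (xc _ sub0) mul0r subr0.
case: eqP => [hv|_]; last by rewrite mul0r mulr0.
have := size_word v; move: hv vc; case E : (word v) => [//|j w] /= [->] vc _.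
rewrite eqxx in vc; rewrite /tree_fun; case: w E vc => [|k w] E vc.
  by rewrite sub0seq in vc.
by rewrite big1 ?mulr0 // => u /eqP uw; apply: xc; rewrite uw.
Qed.

(** The transposed shift only deletes a first letter, so no word outside the subwords of [c]
    appears. *)
Lemma tree_supported_grad_x c i y : tree_supported c y ->
  tree_supported c (y *m (tree_mx i)^T).
Proof.
move=> yc u uc; rewrite mxE big1 // => v _; rewrite !mxE.
have [vc|vc] := boolP (subseq (word v) c); last by rewrite yc ?mul0r.
have -> : (word v == l i :: word u) = false.
  apply: contraNF uc => /eqP vu; apply: subseq_trans vc.
  by rewrite vu subseq_cons.
have -> : (u == v) = false by apply: contraNF uc => /eqP ->.
by rewrite mulr0 subr0 mulr0 mulr0.
Qed.

(** * The averaged game: residuals, exact solution and lower bound *)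

Hypothesis l_balanced : forall j, \sum_i (l i == j)%:R = n%:R / q%:R :> R.
Hypotheses (q_gt0 : (0 < q)%N) (n_gt0 : (0 < n)%N) (N_gt0 : (0 < N)%N).

Let Mbar := n%:R^-1 *: \sum_i tree_mx i.
Let cbar := n%:R^-1 *: \sum_i tree_source i.

(** Only the nodes owning the first letter of [word v] pass on the value of its parent, a share
    [1 / q] of all nodes; since [q = b ^+ 2], the factor [a / b] comes out. *)
Lemma average_tree_coord x v : (x *m Mbar + cbar) 0 v =
  a / b * (tree_fun x (behead (word v)) / b - tree_fun x (word v)).
Proof.
have nR : n%:R != 0 :> R by rewrite pnatr_eq0 -lt0n.
have qR : q%:R = b ^+ 2 :> R by rewrite sqr_sqrtr.
have b0 : b != 0 by rewrite gt_eqF // sqrtr_gt0 ltr0n.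
rewrite /Mbar /cbar -scalemxAr mulmx_sumr -scalerDr -big_split /= mxE summxE.
under eq_bigr do rewrite tree_payoff_coord.
rewrite -mulr_sumr sumrB -mulr_suml sumr_const card_ord.
have -> : \sum_i (ohead (word v) == Some (l i))%:R = n%:R / q%:R :> R.
  have := size_word v; case: (word v) => [//|j w] _ /=.
  by rewrite -(l_balanced j); apply: eq_bigr => i _; rewrite eq_sym.
have -> : n%:R / q%:R = n%:R / b ^+ 2 :> R by rewrite -qR.
by rewrite -mulr_natl; field; rewrite b0 nR.
Qed.

(** Each value is that of its parent divided by [b], so all residuals vanish. *)
Definition tree_solution : 'rV[R]_d := \row_v (s / b ^+ size (word v)).

Lemma tree_solutionP : tree_solution *m Mbar + cbar = 0.
Proof.
have b0 : b != 0 by rewrite gt_eqF // sqrtr_gt0 ltr0n.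
have sol w : (size w <= N)%N -> tree_fun tree_solution w = s / b ^+ size w.
  case: w => [|j w] wN; first by rewrite /= expr0 divr1.
  have /(nthP [::])[k kd wk] : j :: w \in tree_words N by rewrite mem_tree_words.
  by rewrite -wk (tree_fun_word _ (Ordinal kd)) mxE.
apply/rowP => v; rewrite average_tree_coord mxE; have /andP[v0 vN] := size_word v.
rewrite !sol // ?size_behead ?(leq_trans (leq_pred _)) //.
case: (size _) v0 => // k _; rewrite exprSr.
rewrite [X in _ * X](_ : _ = 0) ?mulr0 //.
by field; rewrite expf_neq0 ?b0.
Qed.

(** Level [k] has [q ^ k] words of squared value [s ^+ 2 / q ^ k], so each of the [N] levels
    contributes [s ^+ 2]. *)
Lemma sqr_enorm_tree_solution : enorm tree_solution ^+ 2 = N%:R * s ^+ 2.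
Proof.
have b0 : b != 0 by rewrite gt_eqF // sqrtr_gt0 ltr0n.
rewrite sqr_enorm; under eq_bigr do rewrite mxE.
rewrite (sum_word (fun w => (s / b ^+ size w) ^+ 2)) sum_tree_words.
rewrite (eq_bigr (fun=> s ^+ 2)) ?sumr_const ?card_ord ?mulr_natl // => k _.
rewrite big_seq (eq_bigr (fun=> s ^+ 2 / q%:R ^+ k.+1)); last first.
  move=> w; rewrite mem_words => /eqP ->.
  by rewrite expr_div_n exprAC sqr_sqrtr.
rewrite -big_seq big_const_seq count_predT size_words iter_addr_0 -[_ *+ (q ^ _)]mulr_natr.
by rewrite natrX divfK // expf_neq0 // pnatr_eq0 -lt0n.
Qed.

(** The point [x] vanishes at every word of length [N] that is not a subword of [c], which is at
    least 7/8 of them; [words_residual] is applied to these branches. *)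
Lemma tree_residual_ge c x : (32 * size c <= q * N)%N -> tree_supported c x ->
  7 / 8 * (a ^+ 2 * s ^+ 2) <= q%:R * N%:R * enorm (x *m Mbar + cbar) ^+ 2.
Proof.
move=> cN xc; have qR : 0 < q%:R :> R by rewrite ltr0n.
have b0 : b != 0 by rewrite gt_eqF // sqrtr_gt0 ltr0n.
have vanish t : size t = N -> ~~ subseq t c -> tree_fun x t = 0.
  move=> tN tc; rewrite /tree_fun; case: t tN tc => [|j t] tN tc.
    by move: N_gt0; rewrite -tN.
  by rewrite big1 // => u /eqP ut; apply: xc; rewrite ut.
have := words_residual q_gt0 (erefl : tree_fun x [::] = s) vanish.
set S := \sum_(w <- tree_words N) _.
have -> : enorm (x *m Mbar + cbar) ^+ 2 = a ^+ 2 / q%:R * S.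
  rewrite sqr_enorm /S -sum_word mulr_sumr; apply: eq_bigr => v _.
  by rewrite average_tree_coord exprMn expr_div_n sqr_sqrtr.
have few := few_subseq_words R q_gt0 N_gt0 cN.
have qN : 0 < (q ^ N)%:R :> R by rewrite ltr0n expn_gt0 q_gt0.
have many : 7 / 8 * (q ^ N)%:R <= \sum_(t <- words N) (~~ subseq t c)%:R :> R.
  have : \sum_(t <- words N) (~~ subseq t c)%:R + \sum_(t <- words N) (subseq t c)%:R
     = (q ^ N)%:R :> R.
    rewrite -big_split /= -(size_words N) -sum1_size natr_sum.
    by apply: eq_bigr => t _; case: subseq; rewrite /= ?addr0 ?add0r.
  by move: few; lra.
move=> res; have {res} : 7 / 8 * (q ^ N)%:R * s ^+ 2 <= (q ^ N)%:R * (N%:R * S).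
  by apply: le_trans res; rewrite ler_wpM2r ?sqr_ge0.
rewrite mulrAC mulrC ler_pM2l // => res.
have -> : q%:R * N%:R * (a ^+ 2 / q%:R * S) = a ^+ 2 * (N%:R * S).
  by field; rewrite gt_eqF.
by rewrite mulrCA ler_wpM2l ?sqr_ge0.
Qed.

End TreeInstance.

(** * Trajectories *)

Section Trajectory.
Context {R : realType} {q n : nat} (N : nat) (l : 'I_n -> 'I_q) (a s : R).
Local Notation d := (size (@tree_words q N)).
Local Notation f := (fun i => bilinear_payoff (tree_mx N l a i) (tree_source N l a s i)).

Definition call_letter (c : command n) : seq 'I_q :=
  match c with LocalX k | LocalY k => [:: l k] | _ => [::] end.

(** The latest call stands first, because a gradient in y prepends its letter. *)
Fixpoint call_word (cmds : nat -> command n) t : seq 'I_q :=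
  if t is t'.+1 then call_letter (cmds t') ++ call_word cmds t' else [::].

Lemma size_call_word cmds t :
  size (call_word cmds t) = (\sum_(k < t) is_gradient_call (cmds k))%N.
Proof.
elim: t => [|t IHt]; first by rewrite big_ord0.
by rewrite big_ord_recr /= size_cat IHt addnC; case: (cmds t).
Qed.

(** This holds at every sample point, by induction on the step: communication only forms spans,
    whatever the batch, and a local computation adds one gradient at the node whose letter is
    prepended. *)
Lemma memory_supported (disp : measure_display) (T : measurableType disp)
    (P : probability T R) (server : 'I_n) (A : trajectory R n d d T) :
  DFO server f P A -> forall w t i, (t <= stop A w)%N ->
  let c := call_word (fun k => cmd A k w) t in
  memory (newx A) t w i `<=` tree_supported c /\
  memory (newy A) t w i `<=` tree_supported c.
Proof.
move=> dfoA w t i; elim: t i => [|t IHt] i tstop /=.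
  by split=> v [->|[k //]] u _; rewrite mxE.
set c := call_word _ t in IHt *; set c' := call_letter _ ++ c.
have cc' : subseq c c' by apply: suffix_subseq.
have {}IHt i' := IHt i' (ltnW tstop).
have IHx i' v := (IHt i').1 v; have IHy i' v := (IHt i').2 v.
have from_clients_supp (M : 'I_n -> set 'rV[R]_d) S :
    (forall k, M k `<=` tree_supported c) ->
    from_clients server M S i `<=` tree_supported c'.
  move=> Mc v [_ [u uM vspan]]; apply: (tree_supported_sub cc').
  apply: tree_supported_span vspan => u'.
  rewrite inE => /orP[/eqP ->|/mapP[k _ ->]]; exact/Mc/uM.
have from_server_supp (M : 'I_n -> set 'rV[R]_d) S :
    (forall k, M k `<=` tree_supported c) ->
    from_server server M S i `<=` tree_supported c'.
  move=> Mc v [_ _ [v1 [v2 [Mv1 Mv2 vspan]]]]; apply: (tree_supported_sub cc').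
  by apply: tree_supported_span vspan => u'; rewrite !inE => /orP[] /eqP ->;
    apply: Mc; eassumption.
have stepx : tree_supported c' (newx A t w i).
  have := dfo_step_x dfoA i tstop; rewrite /= /c'.
  case=> [/IHx /(tree_supported_sub cc')//|].
  rewrite /c' in from_clients_supp from_server_supp *.
  case: (cmd A t w) from_clients_supp from_server_supp => [b|b|k|k] fc fs /=.
  - by apply: fc => k; apply: IHx.
  - by apply: fs => k; apply: IHx.
  - move=> [_ [x1 [x2 [y2 [Mx1 Mx2 My2 vspan]]]]]; apply: tree_supported_span vspan => u'.
    rewrite !inE => /orP[] /eqP ->; apply: (tree_supported_sub (subseq_cons _ _)).
      exact: IHx Mx1.
    by rewrite gradient_x_bilinear_payoff; apply/tree_supported_grad_x/IHy/My2.
  - by [].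
have stepy : tree_supported c' (newy A t w i).
  have := dfo_step_y dfoA i tstop; rewrite /= /c'.
  case=> [/IHy /(tree_supported_sub cc')//|].
  rewrite /c' in from_clients_supp from_server_supp *.
  case: (cmd A t w) from_clients_supp from_server_supp => [b|b|k|k] fc fs /=.
  - by apply: fc => k; apply: IHy.
  - by apply: fs => k; apply: IHy.
  - by [].
  - move=> [_ [y1 [x2 [y2 [My1 Mx2 My2 vspan]]]]]; apply: tree_supported_span vspan => u'.
    rewrite !inE => /orP[] /eqP ->.
      by apply: (tree_supported_sub (subseq_cons _ _)); apply: IHy My1.
    by rewrite gradient_y_bilinear_payoff; apply/tree_supported_grad_y/IHx/Mx2.
have mem_step (new : nat -> T -> 'I_n -> 'rV[R]_d) :
    memory new t w i `<=` tree_supported c -> tree_supported c' (new t w i) ->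
    memory new t.+1 w i `<=` tree_supported c'.
  move=> Mc newc v [->|[k]]; first by move=> u _; rewrite mxE.
  rewrite ltnS leq_eqVlt => /orP[/eqP -> -> //|kt ->].
  by apply: (tree_supported_sub cc'); apply: Mc; right; exists k.
by split; apply: mem_step => //; [exact: IHx|exact: IHy].
Qed.

End Trajectory.

(** * Lower bounds on expectations and measurability of the number of calls *)

Section Probability.
Context (R : realType) (disp : measure_display) (T : measurableType disp)
  (P : probability T R).

(* The integrand need not be measurable: the integral of a nonnegative function
   is a supremum over the simple functions below it. *)
Lemma expectation_ge (f : T -> R) (A : set T) (k : R) :
  measurable A -> 0 <= k -> (forall w, 0 <= f w) -> (forall w, A w -> k <= f w) ->
  (k%:E * P A <= 'E_P[f])%E.
Proof.
move=> mA k0 f0 fA; rewrite unlock.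
have kA w : (k * \1_A w <= f w).
  rewrite indicE; have [Aw|nAw] := pselect (A w).
    by rewrite mem_set // mulr1 fA.
  by rewrite memNset // mulr0.
have -> : (k%:E * P A = \int[P]_w (k * \1_A w)%:E)%E.
  under eq_integral do rewrite EFinM.
  rewrite ge0_integralZl_EFin ?integral_indic ?setIT //.
  exact/measurable_realfun.measurable_EFinP.
rewrite !ge0_integralTE; last 2 first.
- by move=> w; rewrite lee_fin ?mulr_ge0.
- by move=> w; rewrite lee_fin ?mulr_ge0.
apply: ereal_sup_le => _ [h /= hk <-]; exists h => // w.
by apply: le_trans (hk w) _; rewrite lee_fin.
Qed.

(** The stopping time and the partial counts are integer-valued with measurable level sets, so the
    event is a countable union over their values. *)
Lemma measurable_gradient_calls n dx dy (server : 'I_n)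
    (f : 'I_n -> 'rV[R]_(dx + dy) -> R) (A : trajectory R n dx dy T) (k : nat) :
  DFO server f P A -> measurable [set w | (32 * gradient_calls A w <= k)%N].
Proof.
move=> dfoA.
have meas t (B : set T) : known A t B -> measurable B.
  exact: (dfo_measurable dfoA).
have mcall t : measurable [set w | is_gradient_call (cmd A t w)].
  have -> : [set w | is_gradient_call (cmd A t w)] =
      \bigcup_(i : 'I_n) (cmd A t @^-1` [set LocalX i] `|` cmd A t @^-1` [set LocalY i]).
    apply/seteqP; split=> w /=.
      by case E : (cmd A t w) => [//|//|i|i] _; exists i => //; rewrite /= E; [left|right].
    by move=> [i _ /= []] ->.
  apply: fin_bigcup_measurable => // i _.
  by apply: measurableU; apply: (meas t); apply: (dfo_cmd dfoA).
have msum t j : measurable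
    [set w | (\sum_(r < t) is_gradient_call (cmd A r w))%N = j].
  elim: t j => [|t IHt] j.
    have [->|j0] := eqVneq j 0%N.
      rewrite (_ : [set _ | _] = setT) //.
      by apply/seteqP; split=> w //= _; rewrite big_ord0.
    rewrite (_ : [set _ | _] = set0) //.
    apply/seteqP; split=> w //=; rewrite big_ord0 => j0'.
    by rewrite -j0' eqxx in j0.
  have -> : [set w | (\sum_(r < t.+1) is_gradient_call (cmd A r w))%N = j] =
     ([set w | is_gradient_call (cmd A t w)] `&`
      [set w | (\sum_(r < t) is_gradient_call (cmd A r w)).+1%N = j]) `|`
     (~` [set w | is_gradient_call (cmd A t w)] `&`
      [set w | (\sum_(r < t) is_gradient_call (cmd A r w))%N = j]).
    apply/seteqP; split=> w /=; rewrite big_ord_recr /=.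
      case: is_gradient_call; rewrite ?addn1 ?addn0 => ->; by [left|right].
    by case: is_gradient_call => -[[h <-]|[h <-]] //; rewrite ?addn1 ?addn0.
  apply: measurableU; apply: measurableI => //; last exact: measurableC.
  case: j => [|j]; first by rewrite (_ : [set _ | _] = set0) //; apply/seteqP; split.
  have := IHt j; congr (measurable _); apply/seteqP; split=> w /=; first by move=> ->.
  by case.
have -> : [set w | (32 * gradient_calls A w <= k)%N] =
    \bigcup_t (stop A @^-1` [set t] `&`
      \bigcup_(j in [set j | (32 * j <= k)%N])
        [set w | (\sum_(r < t) is_gradient_call (cmd A r w))%N = j]).
  apply/seteqP; split=> w /=.
    by move=> wk; exists (stop A w) => //; split => //; exists (gradient_calls A w).
  by move=> [t _ [/= <- [j /= jk jE]]]; rewrite /gradient_calls jE.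
apply: bigcup_measurable => t _; apply: measurableI.
  by apply: (meas t); apply: (dfo_stop dfoA).
by apply: bigcup_measurable => j _; apply: msum.
Qed.

End Probability.

(** * Lower bound *)

Section LowerBound.
Context {R : realType} {q n : nat} (N : nat) (l : 'I_n -> 'I_q) (a D eps : R).
Hypotheses (q_gt0 : (0 < q)%N) (n_gt0 : (0 < n)%N) (N_gt0 : (0 < N)%N).
Hypotheses (a_gt0 : 0 < a) (D_gt0 : 0 < D) (eps_gt0 : 0 < eps).
Hypothesis l_balanced : forall j, \sum_i (l i == j)%:R = n%:R / q%:R :> R.
Hypothesis N_small : N%:R * (16 * Num.sqrt (2 * q%:R) * eps) <= 2 * a * D ^+ 2.

Local Notation d := (size (@tree_words q N)).
(** The radius [r] gives the product of the two balls diameter [D], and [s] gives [tree_solution]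
    norm exactly [r]. *)
Let r : R := D / (2 * Num.sqrt 2).
Let s : R := r / Num.sqrt N%:R.

Definition tree_payoff (i : 'I_n) : 'rV[R]_(d + d) -> R :=
  bilinear_payoff (tree_mx N l a i) (tree_source N l a s i).

Let sqr_r : 8 * r ^+ 2 = D ^+ 2.
Proof.
by rewrite /r expr_div_n exprMn sqr_sqrtr //; field.
Qed.

Let r_gt0 : 0 < r.
Proof. by rewrite divr_gt0 // mulr_gt0 // sqrtr_gt0. Qed.

Let sqr_s : N%:R * s ^+ 2 = r ^+ 2.
Proof.
have N0 : N%:R != 0 :> R by rewrite pnatr_eq0 -lt0n.
by rewrite /s expr_div_n sqr_sqrtr //; field.
Qed.

(** Here [e] is the norm of the averaged coupling at [x]. The first bound holds at every point and
    shows that the gap is nonnegative; the second concerns points reached with few calls. *)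
Lemma Gap_tree_payoff_ge x y : exists2 e, 0 <= e &
  r * e <= Gap (average tree_payoff) (@eball R d r) (@eball R d r) x y /\
  forall c, (32 * size c <= q * N)%N -> tree_supported c x ->
    5 / 4 * eps <= r * e.
Proof.
rewrite average_bilinear_payoff.
exists (enorm (x *m (n%:R^-1 *: \sum_i tree_mx N l a i) +
               n%:R^-1 *: \sum_i tree_source N l a s i)); first exact: enorm_ge0.
split.
  apply: (@Gap_bilinear_payoff_ge _ _ _ _ _ _ (tree_solution N s)).
    apply: enorm_le; first exact: ltW.
    by rewrite -sqr_enorm sqr_enorm_tree_solution // sqr_s.
  exact: tree_solutionP.
move=> c cN xc; set e := enorm _.
have := tree_residual_ge a s l_balanced q_gt0 n_gt0 N_gt0 cN xc.
rewrite -/e => res.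
have e0 : 0 <= e by apply: enorm_ge0.
have [[[r0 a0] eps0] D0] := (ltW r_gt0, ltW a_gt0, ltW eps_gt0, ltW D_gt0).
rewrite -(@ler_sqr R) ?nnegrE ?mulr_ge0 //.
rewrite (exprMn _ r e).
have qR : 0 < q%:R :> R by rewrite ltr0n.
have NR : 0 < N%:R :> R by rewrite ltr0n.
(* As [D ^+ 2 = 8 * r ^+ 2], this says [2 q N^2 eps^2 <= a^2 r^4]. With the factor 7/8 it yields
   [(r e)^2 >= 7/4 eps^2], and [(5/4)^2 < 7/4]. *)
have Neps : (N%:R * (16 * Num.sqrt (2 * q%:R) * eps)) ^+ 2 <= (2 * a * D ^+ 2) ^+ 2.
  by rewrite ler_sqr ?nnegrE ?mulr_ge0 ?sqr_ge0 ?sqrtr_ge0 ?ler0n.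
rewrite !exprMn sqr_sqrtr ?mulr_ge0 ?ler0n // -sqr_r in Neps.
have qN2 : 0 < q%:R * N%:R ^+ 2 :> R by rewrite mulr_gt0 ?exprn_gt0.
rewrite -(ler_pM2l qN2).
have res' : 7 / 8 * (a ^+ 2 * r ^+ 2 * r ^+ 2) <=
    q%:R * N%:R ^+ 2 * (r ^+ 2 * e ^+ 2).
  have : (N%:R * r ^+ 2) * (7 / 8 * (a ^+ 2 * s ^+ 2)) <=
      (N%:R * r ^+ 2) * (q%:R * N%:R * e ^+ 2).
    by rewrite ler_pM2l // mulr_gt0 ?exprn_gt0.
  have -> : (N%:R * r ^+ 2) * (7 / 8 * (a ^+ 2 * s ^+ 2)) =
      7 / 8 * (a ^+ 2 * (N%:R * s ^+ 2) * r ^+ 2) by ring.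
  rewrite sqr_s => h; apply: le_trans h _; apply: eq_ler; ring.
apply: le_trans res'; move: Neps.
have : 0 <= q%:R * N%:R ^+ 2 * eps ^+ 2 by rewrite mulr_ge0 ?sqr_ge0 ?ltW.
lra.
Qed.

(** This is a Markov argument: the gap is at least [5/4 eps] on the event [E] of few calls, so [E]
    has probability at most 4/5. Off [E] there are more than [q N / 32] calls, and
    [1/5 * 1/32 = 1/160]. *)
Lemma tree_payoff_gradient_calls (disp : measure_display)
    (T : measurableType disp) (P : probability T R) (server : 'I_n)
    (A : trajectory R n d d T) :
  DFO server tree_payoff P A ->
  ('E_P[fun w => Gap (average tree_payoff) (@eball R d r) (@eball R d r)
                     (outx A w) (outy A w)] <= eps%:E)%E ->
  (((q * N)%:R / 160)%:E <= 'E_P[fun w => (gradient_calls A w)%:R])%E.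
Proof.
move=> dfoA Egap.
pose E := [set w | (32 * gradient_calls A w <= q * N)%N].
have mE : measurable E := measurable_gradient_calls (q * N) dfoA.
have gap_E w : E w -> 5 / 4 * eps <=
    Gap (average tree_payoff) (@eball R d r) (@eball R d r) (outx A w) (outy A w).
  move=> Ew; have [e _ [eG]] := Gap_tree_payoff_ge (outx A w) (outy A w).
  move=> /(_ (call_word l (fun k => cmd A k w) (stop A w))) h; apply: le_trans eG.
  apply: h; first by rewrite size_call_word.
  have [memx _] := memory_supported (l := l) (a := a) (s := s) dfoA server
    (leqnn (stop A w)).
  exact/memx/(dfo_output_x dfoA).
have gap_ge0 w : 0 <=
    Gap (average tree_payoff) (@eball R d r) (@eball R d r) (outx A w) (outy A w).
  have [e e0 [eG _]] := Gap_tree_payoff_ge (outx A w) (outy A w).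
  by apply: le_trans eG; rewrite mulr_ge0 // ltW.
have k0 : 0 <= 5 / 4 * eps by rewrite mulr_ge0 // ltW.
have PE := le_trans (expectation_ge P mE k0 gap_ge0 gap_E) Egap.
have {}PE : fine (P E) <= 4 / 5.
  move: PE; rewrite -[P E]fineK ?fin_num_measure // -EFinM lee_fin /= => h.
  by rewrite -(ler_pM2l eps_gt0); lra.
have mCE : measurable (~` E) by exact: measurableC.
apply: le_trans (expectation_ge P mCE (_ : 0 <= (q * N)%:R / 32) _ _).
- rewrite probability_setC // -[P E]fineK ?fin_num_measure //.
  rewrite -EFinB -EFinM lee_fin.
  have : 0 <= (q * N)%:R :> R by [].
  by move: PE; nra.
- by rewrite divr_ge0.
- by [].
- move=> w /negP; rewrite -ltnNge => /ltnW h.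
  by rewrite ler_pdivrMr // -natrM ler_nat [leqRHS]mulnC.
Qed.

(** Similarity has two sources: a small [a], or a single common letter, in which case all matrices
    coincide and the Hessians do not deviate at all. *)
Lemma tree_payoff_instance (delta L : R) : 2 * a <= L -> 0 <= delta ->
  2 * a <= delta \/ (forall i k, l i = l k) ->
  let X := @eball R d r in
  (0 < d)%N /\ (forall i, L_smooth L (tree_payoff i)) /\
  (forall i, convex_concave (tree_payoff i)) /\
  second_order_similarity delta tree_payoff /\
  (product_set X X !=set0 /\ closed (product_set X X) /\
   convex_set (product_set X X) /\ has_diameter D (product_set X X)).
Proof.
move=> aL delta0 sim X; split; first exact: size_tree_words_gt0.
split=> [i|].
  apply: L_smooth_bilinear_payoff => [|x].
    by apply: le_trans aL; rewrite mulr_ge0 // ltW.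
  apply: le_trans (enorm_tree_mx l i x (ltW a_gt0) q_gt0) _.
  by rewrite ler_wpM2r ?enorm_ge0.
split=> [i|]; first exact: convex_concave_bilinear_payoff.
split.
  apply: second_order_similarity_bilinear_payoff => // i x.
  case: sim => [ad|l_const].
    apply: le_trans (enorm_tree_mx_average l i x (ltW a_gt0) n_gt0) _.
    by rewrite ler_wpM2r ?enorm_ge0.
  rewrite (eq_bigr (fun=> tree_mx N l a i)) => [|k _]; last first.
    by apply/matrixP => u v; rewrite !mxE (l_const k i).
  rewrite sumr_const card_ord -(scaler_nat n (tree_mx N l a i)) scalerA.
  rewrite mulVf ?pnatr_eq0 -?lt0n //.
  by rewrite scale1r subrr mulmx0 enorm0 mulr_ge0 ?enorm_ge0.
split; first by exists 0; split; rewrite /= /X /eball /= ?linear0 enorm0 ltW.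
split; first exact: closed_product_eball.
split; first exact: convex_product_eball.
by apply: diameter_product_eball; [exact: ltW|rewrite sqr_r].
Qed.

End LowerBound.

(** The depth [N] is the integer part of [rho], the largest one that [N_small] allows. As
    [rho >= 1], rounding loses at most a factor 2, which turns 160 into 320. *)
Lemma tree_hard_instance (R : realType) (q n : nat) (hn : (1 < n)%N)
    (l : 'I_n -> 'I_q) (a delta L D eps c : R) :
  (0 < q)%N -> (forall j, \sum_i (l i == j)%:R = n%:R / q%:R :> R) ->
  0 < a -> 2 * a <= L -> 0 <= delta ->
  2 * a <= delta \/ (forall i k, l i = l k) -> 0 < D -> 0 < eps ->
  16 * Num.sqrt (2 * q%:R) * eps <= 2 * a * D ^+ 2 ->
  c <= q%:R * (2 * a * D ^+ 2 / (16 * Num.sqrt (2 * q%:R) * eps)) / 320 ->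
  exists (dx dy : nat) (f : 'I_n -> 'rV[R]_(dx + dy) -> R)
         (X : set 'rV[R]_dx) (Y : set 'rV[R]_dy),
    ((0 < dx)%N /\ (0 < dy)%N) /\
    (forall i, L_smooth L (f i)) /\
    (forall i, convex_concave (f i)) /\
    second_order_similarity delta f /\
    (product_set X Y !=set0 /\ closed (product_set X Y) /\
     convex_set (product_set X Y) /\ has_diameter D (product_set X Y)) /\
    forall (d : measure_display) (T : measurableType d) (P : probability T R)
           (A : trajectory R n dx dy T),
      DFO (Ordinal (ltnW hn)) f P A ->
      ('E_P[fun w => Gap (average f) X Y (outx A w) (outy A w)] <= eps%:E)%E ->
      (c%:E <= 'E_P[fun w => (gradient_calls A w)%:R])%E.
Proof.
move=> q_gt0 l_bal a_gt0 aL delta0 sim D_gt0 eps_gt0 rho1 cq.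
have n_gt0 : (0 < n)%N := ltnW hn.
set m := 16 * Num.sqrt (2 * q%:R) * eps in rho1 cq.
have m_gt0 : 0 < m by rewrite !mulr_gt0 // sqrtr_gt0 mulr_gt0 // ltr0n.
set rho := 2 * a * D ^+ 2 / m in cq.
have rho_ge1 : 1 <= rho by rewrite ler_pdivlMr // mul1r.
have rho_ge0 : 0 <= rho by apply: le_trans rho_ge1.
pose N := Num.truncn rho.
have /andP[N_le N_gt] := truncn_itv rho_ge0.
have N_gt0 : (0 < N)%N by rewrite truncn_gt0.
have N_small : N%:R * m <= 2 * a * D ^+ 2 by rewrite -ler_pdivlMr.
have [d_gt0 [smooth [cc [similar sets]]]] :=
  tree_payoff_instance q_gt0 n_gt0 N_gt0 a_gt0 D_gt0 aL delta0 sim.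
exists (size (@tree_words q N)), (size (@tree_words q N)), (tree_payoff (N := N) l a D).
do 2 eexists; do 5 (split; first by [eassumption|split; eassumption]).
move=> d T P A dfoA Egap.
apply: le_trans (tree_payoff_gradient_calls q_gt0 n_gt0 N_gt0 a_gt0 D_gt0
  eps_gt0 l_bal N_small dfoA Egap).
rewrite lee_fin; apply: le_trans cq _; rewrite natrM -/N.
have N1 : 1 <= N%:R :> R by rewrite ler1n.
have rhoN : rho <= 2 * N%:R.
  by move: N_gt; rewrite -natr1 -/N; lra.
rewrite -[leRHS]mulrA -[leLHS]mulrA; apply: ler_wpM2l; first exact: ler0n.
by lra.
Qed.

Theorem theorem5 (R : realType) :
  exists2 c0 : R, 0 < c0 &
  forall (n : nat) (hn : (1 < n)%N) (delta L D eps : R),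
    0 < delta -> delta <= L -> 0 < D ->
    0 < eps -> eps <= delta * D ^+ 2 / (16 * Num.sqrt (2 * n%:R)) ->
  exists (dx dy : nat) (f : 'I_n -> 'rV[R]_(dx + dy) -> R)
         (X : set 'rV[R]_dx) (Y : set 'rV[R]_dy),
    ((0 < dx)%N /\ (0 < dy)%N) /\
    (forall i, L_smooth L (f i)) /\
    (forall i, convex_concave (f i)) /\
    second_order_similarity delta f /\
    (product_set X Y !=set0 /\ closed (product_set X Y) /\
     convex_set (product_set X Y) /\ has_diameter D (product_set X Y)) /\
    forall (d : measure_display) (T : measurableType d) (P : probability T R)
           (a : trajectory R n dx dy T),
      DFO (Ordinal (ltnW hn)) f P a ->
      ('E_P[fun w => Gap (average f) X Y (outx a w) (outy a w)] <= eps%:E)%E ->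
      ((c0 * (n%:R + (Num.sqrt n%:R * delta + L) * D ^+ 2 / eps))%:E
         <= 'E_P[fun w => (gradient_calls a w)%:R])%E.
Proof.
(* Here [30720 = 16 * 320 * 2 * 3]: the first two factors come from [tree_hard_instance], 2 bounds
   [Num.sqrt 2], and 3 compares the whole sum with its dominant term. *)
exists (30720%:R^-1); first by rewrite invr_gt0 ltr0n.
move=> n hn delta L D eps delta_gt0 dL D_gt0 eps_gt0 eps_small.
have L_gt0 : 0 < L := lt_le_trans delta_gt0 dL.
have n_gt0 : 0 < n%:R :> R by rewrite ltr0n ltnW.
pose t : R := Num.sqrt n%:R; have t_gt0 : 0 < t by rewrite sqrtr_gt0.
have t2 : t ^+ 2 = n%:R by rewrite sqr_sqrtr ?ltW.
have t_ge1 : 1 <= t.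
  by rewrite -[leLHS]sqrtr1 ler_wsqrtr // ler1n; apply: ltnW.
pose z : R := Num.sqrt 2; have z2 : z ^+ 2 = 2 by rewrite sqr_sqrtr.
have z_gt0 : 0 < z by rewrite sqrtr_gt0.
have z_le2 : z <= 2 by rewrite -ler_sqr ?nnegrE ?(ltW z_gt0) // z2; lra.
have z_ge1 : 1 <= z by rewrite -ler_sqr ?nnegrE ?(ltW z_gt0) // z2; lra.
have sqrt2n : Num.sqrt (2 * n%:R) = z * t by rewrite sqrtrM.
pose K := D ^+ 2 / eps; have K_gt0 : 0 < K by rewrite divr_gt0 ?exprn_gt0.
have small : 16 * (z * t) * eps <= delta * D ^+ 2.
  move: eps_small; rewrite sqrt2n ler_pdivlMr ?mulr_gt0 //.
  by rewrite [leLHS]mulrC.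
have DK : D ^+ 2 = K * eps by rewrite divfK // gt_eqF.
(* The bound on [eps] reads [16 * z * t <= delta * K]; multiplying by [t] absorbs [n = t ^+ 2]. *)
have nK : n%:R <= t * delta * K.
  have : 16 * (z * t) <= delta * K.
    by rewrite -(ler_pM2r eps_gt0) -[leRHS]mulrA -DK.
  rewrite -t2 expr2 -mulrA ler_pM2l //; apply: le_trans.
  by nra.
have -> : (t * delta + L) * D ^+ 2 / eps = (t * delta + L) * K by rewrite /K mulrA.
(* The larger of [t * delta] and [L] selects the instance: distinct letters with [a = delta / 2], or
   one common letter with [a = L / 2]. *)
case: (leP L (t * delta)) => [Lt|tL].
  apply: (@tree_hard_instance R n n hn id (delta / 2) delta L D eps) => //.
  - exact: ltnW.
  - move=> j; rewrite divff ?gt_eqF // (bigD1 j) //= eqxx big1 ?addr0 // => i.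
    by move/negbTE->.
  - by rewrite divr_gt0.
  - by rewrite mulrC divfK.
  - exact: ltW.
  - by left; rewrite mulrC divfK.
  - by rewrite sqrt2n [2 * _]mulrC divfK.
  rewrite sqrt2n [2 * _]mulrC divfK // DK -t2.
  have -> : t ^+ 2 * (delta * (K * eps) / (16 * (z * t) * eps)) / 320 =
      t * delta * K / (5120%:R * z).
    by field; rewrite !gt_eqF.
  rewrite ler_pdivlMr ?mulr_gt0 // mulrC.
  have : (t * delta + L) * K <= 2 * (t * delta * K).
    by rewrite mulrA ler_pM2r //; lra.
  move: nK; rewrite -t2; nra.
apply: (@tree_hard_instance R 1 n hn (fun=> ord0) (L / 2) delta L D eps) => //.
- move=> j; rewrite (eq_bigr (fun=> 1)) => [|i _]; last by rewrite (ord1 j).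
  by rewrite sumr_const card_ord divr1.
- by rewrite divr_gt0.
- by rewrite mulrC divfK.
- exact: ltW.
- by right.
- rewrite mulr1 -/z [2 * _]mulrC divfK //.
  (* The requirement for [q = 1] follows from the one for [q = n], since [1 <= t] and
     [delta <= L]. *)
  apply: (@le_trans _ _ (16 * (z * t) * eps)).
    by rewrite ler_pM2r // ler_pM2l // ler_peMr // ltW.
  by apply: le_trans small _; rewrite ler_wpM2r // exprn_ge0 // ltW.
rewrite mulr1 -/z [2 * _]mulrC divfK // DK mul1r.
have -> : L * (K * eps) / (16 * z * eps) / 320 = L * K / (5120%:R * z).
  by field; rewrite !gt_eqF.
rewrite ler_pdivlMr ?mulr_gt0 // mulrC.
have : (t * delta + L) * K <= 2 * (L * K) by rewrite mulrA ler_pM2r //; lra.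
have : t * delta * K <= L * K by rewrite ler_pM2r // ltW.
nra.
Qed.
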